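(* For $n\ge 0$ let $c_{2,n}(x)=\sum_{k=0}^{n} \left[{n\atop k}\right]^{(2)} x^k$ be the second-order Stirling cycle polynomial. Then the sequence $(c_{2,n}(x))_{n\geq 0}$ is coefficientwise Hankel-totally positive in the variable $x$; that is, every minor of the infinite Hankel matrix $(c_{2,i+j}(x))_{i,j\ge 0}$ is a polynomial in $x$ with nonnegative coefficients.
   Context: For integers $n,k\ge 0$, the second-order Stirling cycle number $\left[{n\atop k}\right]^{(2)}$ is the number of permutations of $[n+k]=\{1,\ldots,n+k\}$ having exactly $k$ cycles, all of which have size $\ge 2$ (i.e. derangements of $[n+k]$ with $k$ cycles); in particular $\left[{0\atop 0}\right]^{(2)}=1$. A minor of an infinite matrix is the determinant of a finite square submatrix formed by choosing finitely many rows $i_1<\dots<i_m$ and columns $j_1<\dots<j_m$. *)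

(* Defs.v *)
From mathcomp Require Import all_boot all_order all_algebra all_fingroup.

Set Implicit Arguments.
Unset Strict Implicit.
Unset Printing Implicit Defensive.

Import Order.TTheory GRing.Theory Num.Theory.
Local Open Scope ring_scope.

(* Fixed points belong to [porbits s] as singletons, so the second condition
   says that [s] has no cycle of size 1. *)
Definition stirling_cycle2 (n k : nat) : nat :=
  #|[set s : {perm 'I_(n + k)%N} |
      (#|porbits s| == k) && [forall c in porbits s, (2 <= #|c|)%N]]|.

Definition stirling_cycle2_poly (n : nat) : {poly int} :=
  \sum_(0 <= k < n.+1) (stirling_cycle2 n k)%:R *: 'X^k.

Definition hankel_matrix (T : Type) (a : nat -> T) : nat -> nat -> T :=
  fun i j => a (i + j)%N.

Definition increasing_selection (m : nat) (r : 'I_m -> nat) : Prop :=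
  forall i j : 'I_m, (i < j)%N -> (r i < r j)%N.

Definition minor_of (R : comNzRingType) (A : nat -> nat -> R) (m : nat)
    (r c : 'I_m -> nat) : R :=
  \det (\matrix_(i < m, j < m) A (r i) (c j)).

Definition coefficientwise_totally_positive
    (A : nat -> nat -> {poly int}) : Prop :=
  forall (m : nat) (r c : 'I_m -> nat),
    increasing_selection r -> increasing_selection c ->
    forall d : nat, 0 <= (minor_of A r c)`_d.

Definition coefficientwise_hankel_totally_positive
    (a : nat -> {poly int}) : Prop :=
  coefficientwise_totally_positive (hankel_matrix a).

(* Main.v *)
(** Write [c(n,k)] for the second-order Stirling cycle numbers,
    [v = 1 + x b] and [y = 1 + (1 + x) b].  The derivation [D = y^2 v d/db]
    maps [v y^m] to [v ((m + 1) x y^(m+2) + m y^(m+1))]; comparing with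
    [c(n+1,k) = (n + k) (c(n,k) + c(n,k-1))] gives
    [D^n v = v * sum_k c(n,k) x^k y^(n+k)], whose value at [b = 0] is
    [c_{2,n}(x)].  In the basis [(v b^k)_k] the matrix [P] of [D] is the product
    of two copies of multiplication by [y] and of the matrix of
    [b^k |-> (k + 1) x b^k + k b^(k-1)].  These are bidiagonal with
    coefficientwise nonnegative entries, so [P] is totally positive.  The Hankel
    matrix with entries [(P^(i+j))_00] is the product of the matrices
    [((P^i)_0k)_{i,k}] and [((P^j)_k0)_{k,j}]; each of these is totally positive
    because it is obtained by alternately multiplying by [P] and adjoining the
    row, or column, [(1, 0, 0, ...)]. *)

Require Import Defs.
From mathcomp Require Import all_boot all_order all_algebra all_fingroup.
From mathcomp Require Import ring zify.

Set Implicit Arguments.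
Unset Strict Implicit.
Unset Printing Implicit Defensive.

Import Order.TTheory GRing.Theory Num.Theory.
Local Open Scope ring_scope.

(** * Total positivity *)

Notation tp := coefficientwise_totally_positive.

(** As a [polyOver] predicate it gets closure under sums and products from the [rpred] lemmas. *)
Notation nonneg_coefs p := (p \is a polyOver (@Num.Def.nneg_num_pred int)).

Lemma nonneg_coefsP (p : {poly int}) :
  reflect (forall d, 0 <= p`_d) (nonneg_coefs p).
Proof. by apply: (iffP polyOverP) => h d; exact: h. Qed.

Lemma nonneg_coefs_mulrn (p : {poly int}) n :
  nonneg_coefs (p *+ n.+1) = nonneg_coefs p.
Proof.
apply/nonneg_coefsP/nonneg_coefsP => h d; move: (h d);
  by rewrite coefMn pmulrn_lge0.
Qed.

Lemma tpP (A : nat -> nat -> {poly int}) :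
  tp A <-> forall m (r c : 'I_m -> nat), increasing_selection r ->
    increasing_selection c -> nonneg_coefs (minor_of A r c).
Proof.
split=> h m r c hr hc; first by apply/nonneg_coefsP => d; apply: h.
by move=> d; apply/nonneg_coefsP/h.
Qed.

Lemma eq_minor_of (A B : nat -> nat -> {poly int}) m (r c : 'I_m -> nat) :
  (forall i j, A (r i) (c j) = B (r i) (c j)) ->
  minor_of A r c = minor_of B r c.
Proof. by move=> eqAB; congr (\det _); apply/matrixP => i j; rewrite !mxE. Qed.

Lemma eq_tp (A B : nat -> nat -> {poly int}) : A =2 B -> tp A -> tp B.
Proof.
by move=> eqAB tpA m r c hr hc d; rewrite -(@eq_minor_of A) //; exact: tpA.
Qed.

Lemma tp_tr (A : nat -> nat -> {poly int}) : tp A -> tp (fun i j => A j i).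
Proof.
move=> tpA m r c hr hc d; rewrite /minor_of -det_tr.
have -> : (\matrix_(i, j) A (c j) (r i))^T = \matrix_(i, j) A (c i) (r j).
  by apply/matrixP => i j; rewrite !mxE.
exact: tpA.
Qed.

(** * Minors of a product of matrices *)

Lemma increasing_sort m (f : 'I_m -> nat) : injective f ->
  exists s : 'S_m, increasing_selection (f \o s).
Proof.
move=> inj_f; pose t := [tuple f i | i < m].
have /tuple_permP [s Es] : perm_eq (sort_tuple leq t) t by rewrite perm_sort.
exists s => i j lt_ij; have srt : sorted ltn (sort_tuple leq t).
  rewrite ltn_sorted_uniq_leq sort_uniq map_inj_uniq ?enum_uniq //=.
  by rewrite sort_sorted //; apply: leq_total.
have nthE (k : 'I_m) : nth 0%N (sort_tuple leq t) k = f (s k).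
  by rewrite Es (nth_map k) ?size_enum_ord // nth_ord_enum tnth_mktuple.
rewrite /= -!nthE; apply: (sorted_ltn_nth ltn_trans) => //;
  by rewrite inE size_tuple.
Qed.

(** The matrices are infinite; cutting the product off at [N] keeps the sum finite. *)
Definition trunc_mul N (A B : nat -> nat -> {poly int}) i j : {poly int} :=
  \sum_(k < N) A i k * B k j.

Lemma minor_of_colperm (A : nat -> nat -> {poly int}) m (r f : 'I_m -> nat)
    (s : 'S_m) :
  minor_of A r (f \o s) = (-1) ^+ s * minor_of A r f.
Proof.
rewrite mulrC -det_perm /minor_of -(det_tr (perm_mx s)) tr_perm_mx -det_mulmx.
by rewrite -col_permE; congr (\det _); apply/matrixP => i j; rewrite !mxE.
Qed.

Lemma minor_of_rowperm (A : nat -> nat -> {poly int}) m (f c : 'I_m -> nat)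
    (s : 'S_m) :
  minor_of A (f \o s) c = (-1) ^+ s * minor_of A f c.
Proof.
rewrite -det_perm /minor_of -det_mulmx.
by rewrite -row_permE; congr (\det _); apply/matrixP => i j; rewrite !mxE.
Qed.

(* Andreief's identity: summing over all maps [f], not only the increasing ones,
   each product of minors is counted [m`!] times, the signs cancelling out. *)
Lemma andreief N (A B : nat -> nat -> {poly int}) m (r c : 'I_m -> nat) :
  minor_of (trunc_mul N A B) r c *+ m`! =
  \sum_(f : {ffun 'I_m -> 'I_N})
    minor_of A r (val \o f) * minor_of B (val \o f) c.
Proof.
have expand : minor_of (trunc_mul N A B) r c =
    \sum_(f : {ffun 'I_m -> 'I_N})
      (\prod_i A (r i) (f i)) * minor_of B (val \o f) c.
  under [RHS]eq_bigr => f _ do rewrite big_distrr /=.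
  rewrite exchange_big; apply: eq_bigr => s _ /=.
  under [RHS]eq_bigr => f _ do rewrite mulrCA.
  rewrite -big_distrr /=; congr (_ * _).
  under eq_bigr => i _ do rewrite mxE.
  rewrite /trunc_mul bigA_distr_bigA /=; apply: eq_bigr => f _.
  by rewrite -big_split; apply: eq_bigr => i _; rewrite mxE.
under [RHS]eq_bigr => f _ do rewrite big_distrl /=.
rewrite exchange_big /= -card_Sn -sumr_const.
apply: eq_bigr => s _; rewrite expand.
(* Composing [f] with the inverse of [s] turns the term of [s] into [expand]: the sign from
   permuting the rows of [B] cancels the sign of [s]. *)
rewrite [RHS](reindex
  (fun f : {ffun 'I_m -> 'I_N} => [ffun i => f (s^-1%g i)])) /=.
  apply: eq_bigr => f _.
  have -> : minor_of B (val \o [ffun i => f (s^-1%g i)]) c =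
      (-1) ^+ s * minor_of B (val \o f) c.
    rewrite -[s in RHS]invgK odd_permV -minor_of_rowperm; congr (\det _).
    by apply/matrixP => i j; rewrite !mxE /= ffunE.
  rewrite mulrCA !mulrA -expr2 sqrr_sign mul1r; congr (_ * _).
  by apply: eq_bigr => i _; rewrite mxE ffunE permK.
exists (fun f : {ffun 'I_m -> 'I_N} => [ffun i => f (s i)]) => f _;
  by apply/ffunP => i; rewrite !ffunE ?permK ?permKV.
Qed.

Lemma tp_trunc_mul N A B : tp A -> tp B -> tp (trunc_mul N A B).
Proof.
move=> /tpP tpA /tpP tpB; apply/tpP => m r c hr hc.
(* Nonnegativity can be tested after multiplying by the positive integer [m!]. *)
have := fact_gt0 m; case Em: m`! => [//|q] _.
rewrite -(nonneg_coefs_mulrn _ q) -Em andreief; apply: rpred_sum => f _.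
have [/injectiveP inj_f | /injectivePn [i [j neq_ij eq_f]]] :=
  boolP (injectiveb f).
  (* Sorting [f] multiplies both minors by the same sign, so their product is unchanged. *)
  have inj_g : injective (val \o f) by move=> i j /val_inj /inj_f.
  have [s hs] := increasing_sort inj_g.
  have := rpredM (tpA _ _ _ hr hs) (tpB _ _ _ hs hc).
  by rewrite minor_of_colperm minor_of_rowperm mulrACA -expr2 sqrr_sign mul1r.
rewrite [minor_of B _ c](determinant_alternate neq_ij) ?mulr0 ?rpred0 // => k.
by rewrite !mxE /= eq_f.
Qed.

(** * Bidiagonal matrices *)

Lemma increasing_lift m (r : 'I_m.+1 -> nat) :
  increasing_selection r -> increasing_selection (fun i => r (lift ord0 i)).
Proof. by move=> hr i j lt_ij; apply: hr; rewrite /= /bump !leq0n. Qed.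

Lemma increasing_ge0 m (r : 'I_m.+1 -> nat) i :
  increasing_selection r -> (r ord0 <= r i)%N.
Proof.
move=> hr; case: (unliftP ord0 i) => [j|] -> //.
by apply/ltnW/hr; rewrite /= /bump leq0n.
Qed.

Lemma minor_of_row0 (A : nat -> nat -> {poly int}) m (r c : 'I_m.+1 -> nat) :
  (forall j, A (r ord0) (c (lift ord0 j)) = 0) ->
  minor_of A r c = A (r ord0) (c ord0) *
    minor_of A (fun i => r (lift ord0 i)) (fun j => c (lift ord0 j)).
Proof.
move=> A0; rewrite /minor_of (expand_det_row _ ord0) big_ord_recl big1.
  rewrite addr0 mxE /cofactor expr0 mul1r; congr (_ * \det _).
  by apply/matrixP => i j; rewrite !mxE.
by move=> j _; rewrite mxE A0 mul0r.
Qed.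

Lemma minor_of_col0 (A : nat -> nat -> {poly int}) m (r c : 'I_m.+1 -> nat) :
  (forall i, A (r (lift ord0 i)) (c ord0) = 0) ->
  minor_of A r c = A (r ord0) (c ord0) *
    minor_of A (fun i => r (lift ord0 i)) (fun j => c (lift ord0 j)).
Proof.
move=> A0; rewrite /minor_of (expand_det_col _ ord0) big_ord_recl big1.
  rewrite addr0 mxE /cofactor expr0 mul1r; congr (_ * \det _).
  by apply/matrixP => i j; rewrite !mxE.
by move=> j _; rewrite mxE A0 mul0r.
Qed.

(** If [r ord0 <= c ord0], the later columns meet row [r ord0] strictly above the diagonal;
    otherwise the later rows meet column [c ord0] below the subdiagonal. Either way the top left
    entry splits off, and induction on [m] applies. *)
Lemma tp_bidiagonal (A : nat -> nat -> {poly int}) :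
  (forall i j, nonneg_coefs (A i j)) ->
  (forall i j, A i j != 0 -> (j <= i <= j.+1)%N) -> tp A.
Proof.
move=> A_ge0 A_supp; apply/tpP; elim=> [|m IHm] r c hr hc.
  by rewrite /minor_of det_mx00 rpred1.
have A_eq0 i j : ~~ (j <= i <= j.+1)%N -> A i j = 0.
  by apply: contraNeq; apply: A_supp.
have step : minor_of A r c = A (r ord0) (c ord0) *
    minor_of A (fun i => r (lift ord0 i)) (fun j => c (lift ord0 j)).
  have [le_rc | lt_cr] := leqP (r ord0) (c ord0).
    apply: minor_of_row0 => j; apply: A_eq0.
    by have := hc ord0 (lift ord0 j) isT; lia.
  apply: minor_of_col0 => i; apply: A_eq0.
  by have := hr ord0 (lift ord0 i) isT; lia.
by rewrite step rpredM // IHm //; apply: increasing_lift.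
Qed.

(** * Powers of a matrix and Hankel matrices *)

Definition cons_row0 (A : nat -> nat -> {poly int}) i j : {poly int} :=
  if i is i'.+1 then A i' j else (j == 0%N)%:R.

(** A minor avoiding row 0 is a minor of [A] with rows shifted by one. In a minor using row 0, that
    row vanishes after its first entry, since later columns have positive index. *)
Lemma tp_cons_row0 A : tp A -> tp (cons_row0 A).
Proof.
move=> /tpP tpA; apply/tpP => m r c hr hc.
have shift p (r' c' : 'I_p -> nat) : increasing_selection r' ->
    increasing_selection c' -> (forall i, 0 < r' i)%N ->
    nonneg_coefs (minor_of (cons_row0 A) r' c').
  move=> hr' hc' r'_gt0; have := tpA p (fun i => (r' i).-1) c' _ hc'.
  have -> : minor_of A (fun i => (r' i).-1) c' = minor_of (cons_row0 A) r' c'.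
    congr (\det _); apply/matrixP => i j; rewrite !mxE.
    by case: (r' i) (r'_gt0 i).
  by apply=> i j /hr'; have := r'_gt0 i; lia.
case: m r c hr hc => [|m] r c hr hc; first by apply: shift => // -[].
have [r0_eq0 | r0_gt0] := posnP (r ord0); last first.
  by apply: shift => // i; apply: leq_trans (increasing_ge0 i hr).
rewrite minor_of_row0 => [|j].
  rewrite rpredM ?shift //; first by rewrite r0_eq0 /= rpred_nat.
  - exact: increasing_lift.
  - exact: increasing_lift.
  - by move=> i; have := hr ord0 (lift ord0 i) isT; lia.
rewrite r0_eq0 /=; have := hc ord0 (lift ord0 j) isT.
by case: (c (lift _ _)).
Qed.

(* [output N M n k] is the entry [(0, k)] of the [n]-th power of the truncation
   of [M] to its first [N] rows and columns. *)
Fixpoint output N (M : nat -> nat -> {poly int}) n : nat -> {poly int} :=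
  if n is n'.+1 then fun k => \sum_(l < N) output N M n' l * M l k
  else fun k => (k == 0%N)%:R.

Lemma tp_output N M : tp M -> tp (output N M).
Proof.
(* The rule that [output] is [cons_row0] of its own product with [M] is circular; keeping only the
   first [n] rows makes it an induction on [n]. *)
move=> tpM; pose T n i k := if (i < n)%N then output N M i k else 0.
have tpT n : tp (T n).
  elim: n => [|n IHn].
    by apply: tp_bidiagonal => i j; rewrite ?rpred0 ?eqxx.
  apply: eq_tp (tp_cons_row0 (tp_trunc_mul N IHn tpM)) => -[|i] k //=.
  rewrite /trunc_mul /T ltnS; case: ifP => [lt_in | nlt_in] //.
  by apply: big1 => l _; rewrite mul0r.
move=> m r c hr hc d.
rewrite -(@eq_minor_of (T (\max_i r i).+1)) ?tpT // => i j.
by rewrite /T ltnS leq_bigmax.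
Qed.

(** Transposing [M] makes the second factor list column 0 of the powers; factors of [M] then move
    one by one from the first power to the second. *)
Lemma output_mul N M i j : (0 < N)%N ->
  \sum_(k < N) output N M i k * output N (fun a b => M b a) j k =
  output N (fun a b => M b a) (i + j) 0.
Proof.
case: N => // N _; elim: i j => [|i IHi] j.
  rewrite big_ord_recl /= mul1r big1 ?addr0 // => k _.
  by rewrite mul0r.
rewrite addSnnS -IHi /=; under eq_bigr => k _ do rewrite big_distrl /=.
rewrite exchange_big; apply: eq_bigr => l _ /=; rewrite big_distrr.
by apply: eq_bigr => k _; rewrite -mulrA [M _ _ * _]mulrC.
Qed.

(** [M] may depend on the cutoff [N], as truncated products do; a minor involves finitely many
    [a n], so one large [N] serves them all. *)
Lemma hankel_tp_production (a : nat -> {poly int})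
    (M : nat -> nat -> nat -> {poly int}) :
  (forall N, tp (M N)) ->
  (forall n N, (n.*2 < N)%N -> a n = output N (fun i j => M N j i) n 0) ->
  coefficientwise_hankel_totally_positive a.
Proof.
move=> tpM aE m r c hr hc d.
pose K := (\max_i r i + \max_i c i)%N; pose N := K.*2.+1.
have tp1 := tp_output N (tpM N).
have tp2 := tp_tr (tp_output N (tp_tr (tpM N))).
rewrite (@eq_minor_of _ (trunc_mul N (output N (M N))
  (fun i j => output N (fun i j => M N j i) j i))); first exact: tp_trunc_mul.
move=> i j; rewrite /trunc_mul output_mul // -aE // ltnS leq_double.
by rewrite leq_add ?leq_bigmax.
Qed.

(** * The production matrix *)

Section Derivation.

Local Notation x := ('X : {poly int}).
Local Notation b := ('X : {poly {poly int}}).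

(** Column [j] lists the coefficients of [ypoly * b^j]. *)
Definition lower_factor i j : {poly int} :=
  (i == j)%:R + (1 + x) * (i == j.+1)%:R.

(** Column [j] lists the coefficients of [upper_op (b^j)]. *)
Definition upper_factor i j : {poly int} :=
  x *+ i.+1 * (j == i)%:R + (j == i.+1)%:R *+ j.

Definition stirling_production N :=
  trunc_mul N lower_factor (trunc_mul N lower_factor upper_factor).

Lemma tp_stirling_production N : tp (stirling_production N).
Proof.
have x_ge0 : nonneg_coefs x by apply: polyOverX.
have tpL : tp lower_factor.
  apply: tp_bidiagonal => i j.
    by rewrite /lower_factor rpredD ?rpredM ?rpredD ?rpred_nat ?rpred1.
  apply: contraR => h; rewrite /lower_factor.
  have [/negPf-> /negPf->] : i != j /\ i != j.+1 by lia.
  by rewrite mulr0 addr0.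
apply: tp_trunc_mul => //; apply: tp_trunc_mul => //.
apply: (@tp_tr (fun i j => upper_factor j i)).
apply: tp_bidiagonal => i j.
  by rewrite /upper_factor rpredD ?rpredM ?rpredMn ?rpred_nat ?rpred1.
apply: contraR => h; rewrite /upper_factor.
have [/negPf-> /negPf->] : i != j /\ i != j.+1 by lia.
by rewrite mulr0 mul0rn addr0.
Qed.

(** * The production matrix as a differential operator *)

Definition ypoly : {poly {poly int}} := 1 + (1 + x)%:P * b.

(** This is the derivative of [v g], that is, [v d/db] conjugated by [v = 1 + x b]. *)
Definition upper_op (g : {poly {poly int}}) :=
  x%:P * g + (1 + x%:P * b) * g^`().

(* [g |-> v^-1 D (v g)] *)
Definition stirling_op g := ypoly * (ypoly * upper_op g).

Lemma lower_factor_coef N (g : {poly {poly int}}) i : (i < N)%N ->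
  \sum_(k < N) lower_factor i k * g`_k = (ypoly * g)`_i.
Proof.
move=> lt_iN; rewrite /ypoly mulrDl mul1r -mulrA coefD coefCM coefXM.
under eq_bigr => k _ do rewrite mulrDl.
rewrite big_split /=; congr (_ + _).
  rewrite (bigD1 (Ordinal lt_iN)) //= eqxx mul1r big1 ?addr0 // => k.
  by rewrite -val_eqE /= eq_sym => /negPf->; rewrite mul0r.
case: i lt_iN => [|i] lt_iN.
  by rewrite /= mulr0; apply: big1 => k _; rewrite mul0r.
rewrite (bigD1 (Ordinal (ltnW lt_iN))) //= eqxx mulr1 big1 ?addr0 // => k.
by rewrite -val_eqE /= eqSS eq_sym => /negPf->; rewrite mulr0 mul0r.
Qed.

(** The size bound is there for row [i = N - 1], where the derivative reads the coefficient of index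
    [N], outside the sum. *)
Lemma upper_factor_coef N (g : {poly {poly int}}) i :
  (i < N)%N -> (size g <= N)%N ->
  \sum_(k < N) upper_factor i k * g`_k = (upper_op g)`_i.
Proof.
move=> lt_iN le_gN; rewrite /upper_op mulrDl mul1r !coefD -mulrA !coefCM coefXM.
rewrite !coef_deriv.
under eq_bigr => k _ do rewrite mulrDl.
rewrite big_split /= [in RHS]addrCA addrC; congr (_ + _).
  have [lt_i1N | le_Ni1] := ltnP i.+1 N; last first.
    rewrite nth_default ?(leq_trans le_gN) // mul0rn big1 // => k _.
    by rewrite ltn_eqF ?mul0rn ?mul0r // (leq_trans (ltn_ord k)).
  rewrite (bigD1 (Ordinal lt_i1N)) //= eqxx big1 ?addr0 => [|k].
    by rewrite mulr_natl.
  by rewrite -val_eqE /= => /negPf->; rewrite mul0rn mul0r.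
rewrite (bigD1 (Ordinal lt_iN)) //= eqxx mulr1 big1 ?addr0 => [|k].
  case: i lt_iN => [|i] _; first by rewrite mulr0 addr0.
  by rewrite /= mulrnAr mulrnAl mulrS.
by rewrite -val_eqE /= => /negPf->; rewrite mulr0 mul0r.
Qed.

Lemma size_upper_op g : (size (upper_op g) <= size g)%N.
Proof.
apply/leq_sizeP => j le_gj; rewrite /upper_op mulrDl mul1r -mulrA.
rewrite !coefD !coefCM coefXM !coef_deriv.
have g0 i : (j <= i)%N -> g`_i = 0.
  by move=> ?; rewrite nth_default ?(leq_trans le_gj).
rewrite (g0 j) ?(g0 j.+1) ?mul0rn ?mulr0 ?add0r //.
case: eqP => [|/eqP j_neq0]; first by rewrite mulr0.
by rewrite g0 ?prednK ?lt0n // mul0rn mulr0.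
Qed.

Lemma size_stirling_op g : (size (stirling_op g) <= (size g).+2)%N.
Proof.
have sizeY h : (size (ypoly * h)%R <= (size h).+1)%N.
  apply/leq_sizeP => j le_hj; rewrite /ypoly mulrDl mul1r -mulrA.
  rewrite coefD coefCM coefXM.
  by case: j le_hj => // j le_hj; rewrite !nth_default ?mulr0 ?addr0 // ltnW.
rewrite (leq_trans (sizeY _)) // ltnS (leq_trans (sizeY _)) // ltnS.
exact: size_upper_op.
Qed.

Lemma output_stirling_production N n i : (n.*2 < N)%N -> (i < N)%N ->
  output N (fun i j => stirling_production N j i) n i =
  (iter n stirling_op 1)`_i.
Proof.
move=> lt_nN.
(* Each step multiplies by [ypoly] twice, so the degree grows by at most two; hence the condition
   [n.*2 < N]. *)
have size_iter m : (size (iter m stirling_op 1%R) <= m.*2.+1)%N.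
  elim: m => [|m IHm] /=; first by rewrite size_poly1.
  by rewrite (leq_trans (size_stirling_op _)).
elim: n lt_nN i => [|n IHn] lt_nN i lt_iN /=; first by rewrite coef1.
have lt_n'N : (n.*2 < N)%N by apply: ltn_trans lt_nN; rewrite ltn_double.
under eq_bigr => k _ do rewrite IHn ?ltn_ord //.
set g := iter n _ _.
have le_gN : (size g <= N)%N.
  by apply: leq_trans (size_iter n) _.
have trunc_mulE A B (v : nat -> {poly int}) j :
    \sum_(k < N) trunc_mul N A B j k * v k =
    \sum_(l < N) A j l * \sum_(k < N) B l k * v k.
  under eq_bigr => k _ do rewrite big_distrl /=.
  rewrite exchange_big; apply: eq_bigr => l _; rewrite big_distrr.
  by apply: eq_bigr => k _ /=; rewrite mulrA.
under eq_bigr => k _ do rewrite mulrC.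
rewrite (trunc_mulE _ _ (fun k => g`_k)) /stirling_op -(lower_factor_coef _ lt_iN).
apply: eq_bigr => l _; congr (_ * _).
rewrite (trunc_mulE _ _ (fun k => g`_k)) -(@lower_factor_coef N) //.
by apply: eq_bigr => k _; rewrite (@upper_factor_coef N).
Qed.

(* The factor [v = 1 + x b] satisfies [(1 + x) v = 1 + x y], which is why the
   powers of [y] span a space stable under [stirling_op]. *)
Lemma stirling_op_identity (T : comNzRingType) (t u : T) m :
  let y := 1 + (1 + t) * u in
  y * (y * (t * y ^+ m + (1 + t * u) * ((1 + t) * y ^+ m.-1 *+ m))) =
  t *+ m.+1 * y ^+ m.+2 + y ^+ m.+1 *+ m.
Proof.
move=> y; case: m => [|m]; first by rewrite !mulr0n mulr1n; ring.
have vE : (1 + t * u) * (1 + t) = 1 + t * y by rewrite /y; ring.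
rewrite -mulrnAr [(1 + t * u) * _]mulrA vE /= !mulrS.
rewrite -(mulr_natr t) -(mulr_natr (y ^+ m)) -(mulr_natr (y ^+ m.+2)) !exprS.
by move: (y ^+ m) (m%:R) => z k; ring.
Qed.

Lemma stirling_opY m : stirling_op (ypoly ^+ m) =
  (x *+ m.+1)%:P * ypoly ^+ m.+2 + ypoly ^+ m.+1 *+ m.
Proof.
have YE : ypoly = 1 + (1 + x%:P) * b by rewrite /ypoly polyCD.
have dY : ypoly^`() = 1 + x%:P.
  by rewrite derivD derivC derivM derivC derivX mul0r mulr1 !add0r polyCD.
rewrite /stirling_op /upper_op deriv_exp dY polyCMn YE.
exact: stirling_op_identity.
Qed.

Lemma stirling_opD : {morph stirling_op : g h / g + h}.
Proof.
move=> g h; rewrite /stirling_op /upper_op derivD -!mulrDr addrACA.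
by rewrite -!mulrDr.
Qed.

Lemma stirling_opC c g : stirling_op (c%:P * g) = c%:P * stirling_op g.
Proof.
rewrite /stirling_op /upper_op derivM derivC mul0r add0r.
by rewrite ![_ * (c%:P * _)]mulrCA -mulrDr ![_ * (c%:P * _)]mulrCA.
Qed.

(** By [stirling_opY], the term [x^k y^(n+k)] yields [(n+k) x^k y^(n+1+k)] and
    [(n+k+1) x^(k+1) y^(n+1+k+1)], called [F] and [G] below; collecting equal powers gives the
    recurrence of [a]. *)
Lemma iter_stirling_op (a : nat -> nat -> nat) :
  (forall k, a 0%N k = (k == 0%N)) ->
  (forall n, a n.+1 0%N = (n * a n 0)%N) ->
  (forall n k, a n.+1 k.+1 = ((n + k.+1) * (a n k.+1 + a n k))%N) ->
  forall n, iter n stirling_op 1 =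
    \sum_(k < n.+1) ((a n k)%:R *: x ^+ k)%:P * ypoly ^+ (n + k).
Proof.
move=> a0 aS0 aSS; have a_eq0 n k : (n < k)%N -> a n k = 0%N.
  elim: n k => [|n IHn] [|k] //= lt_nk.
  by rewrite aSS !IHn ?muln0 // ltnW.
elim=> [|n IHn]; first by rewrite big_ord1 a0 !expr0 scale1r mulr1.
rewrite iterS {}IHn (big_morph _ stirling_opD (_ : _ = 0)); last first.
  by rewrite /stirling_op /upper_op deriv0 !mulr0 addr0 !mulr0.
pose F k := (((n + k) * a n k)%:R *: x ^+ k)%:P * ypoly ^+ (n.+1 + k).
pose G k := (((n + k.+1) * a n k)%:R *: x ^+ k.+1)%:P * ypoly ^+ (n.+1 + k.+1).
transitivity (\sum_(k < n.+1) (F k + G k)).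
  apply: eq_bigr => k _; rewrite stirling_opC stirling_opY mulrDr addrC /F /G.
  rewrite !addSn !addnS; congr (_ + _).
    by rewrite mulrnAr -mulrnAl -polyCMn -scaler_nat scalerA -natrM.
  rewrite mulrA -polyCM -scalerAl mulrnAr -exprSr; congr (_%:P * _).
  by rewrite -[_ *+ (n + k).+1]scaler_nat scalerA -natrM mulnC.
rewrite big_split /= [RHS]big_ord_recl.
(* Shifting the index adds the term [F n.+1], which is zero. *)
have -> : \sum_(k < n.+1) F k = F 0%N + \sum_(k < n.+1) F k.+1.
  transitivity (\sum_(k < n.+2) F k); last by rewrite big_ord_recl.
  have F0 : F n.+1 = 0 by rewrite /F a_eq0 // muln0 scale0r mul0r.
  by rewrite [RHS]big_ord_recr /= F0 addr0.
rewrite -addrA -big_split; congr (_ + _) => /=.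
  by rewrite /F aS0 addn0.
apply: eq_bigr => k _; rewrite /F /G -mulrDl -polyCD -scalerDl -natrD.
by rewrite -mulnDr -aSS.
Qed.

End Derivation.

(** * The recurrence for derangements with a given number of cycles *)

Section Derangements.

Local Open Scope nat_scope.

(** Separating the number of points from [k] lets the recurrence remove points and cycles
    independently. *)
Definition derangements N k := #|[set s : 'S_N |
  (#|porbits s| == k) && [forall c in porbits s, 2 <= #|c|]]|.

Lemma card_porbit_ge2 N (s : 'S_N) x : (2 <= #|porbit s x|) = (s x != x).
Proof.
have [fix_x | move_x] /= := eqVneq (s x) x.
  suff -> : porbit s x = [set x] by rewrite cards1.
  apply/setP => y; rewrite inE; apply/porbitP/eqP => [[i ->] | ->]; last first.
    by exists 0; rewrite perm1.
  by elim: i => [|i IHi]; rewrite ?perm1 // expgSr permM IHi.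
rewrite (cardsD1 x) porbit_id (cardsD1 (s x)) !inE move_x.
by rewrite (mem_porbit s 1).
Qed.

Lemma forall_card_porbit N (s : 'S_N) :
  [forall c in porbits s, 2 <= #|c|] = [forall x, s x != x].
Proof.
apply/forall_inP/forallP => [big_s x | move_s _ /imsetP [x _ ->]].
  by rewrite -card_porbit_ge2 big_s ?imset_f.
by rewrite card_porbit_ge2.
Qed.

Lemma derangementsE N k : derangements N k =
  \sum_(s : 'S_N) ((#|porbits s| == k) && [forall x, s x != x]).
Proof.
rewrite /derangements -sum1_card big_mkcond; apply: eq_bigr => s _.
by rewrite inE forall_card_porbit; case: ifP.
Qed.

Lemma lift_permX_lift N (s : 'S_N) j i x :
  (lift_perm j j s ^+ i)%g (lift j x) = lift j ((s ^+ i)%g x).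
Proof.
elim: i => [|i IHi]; first by rewrite !expg0 !perm1.
by rewrite !expgSr !permM IHi lift_perm_lift.
Qed.

(** The cycles of [s] are carried over by [lift j], and [j] adds a singleton. *)
Lemma card_porbits_lift N (s : 'S_N) j :
  #|porbits (lift_perm j j s)| = #|porbits s|.+1.
Proof.
have expj i : (lift_perm j j s ^+ i)%g j = j.
  elim: i => [|i IHi]; first by rewrite expg0 perm1.
  by rewrite expgSr permM IHi lift_perm_id.
have orbE x : porbit (lift_perm j j s) (lift j x) = lift j @: porbit s x.
  apply/setP => y; apply/porbitP/imsetP => [[i ->] | [z /porbitP [i ->] ->]].
    by exists ((s ^+ i)%g x); rewrite ?mem_porbit ?lift_permX_lift.
  by exists i; rewrite lift_permX_lift.
have orbj : porbit (lift_perm j j s) j = [set j].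
  apply/setP => y; rewrite inE; apply/porbitP/eqP => [[i ->] | ->].
    exact: expj.
  by exists 0; rewrite perm1.
have -> : porbits (lift_perm j j s) =
    [set j] |: [set lift j @: (O : {set _}) | O in porbits s].
  apply/setP => O; rewrite !inE; apply/imsetP/orP.
    case=> y _ ->; case: (unliftP j y) => [x|] ->; [right | left].
      by rewrite orbE; apply: imset_f; apply: imset_f.
    by rewrite orbj.
  case=> [/eqP -> | /imsetP [_ /imsetP [x _ ->] ->]]; first by exists j.
  by exists (lift j x); rewrite ?orbE.
rewrite cardsU1 card_imset; last exact/imset_inj/lift_inj.
rewrite (_ : _ \notin _ = true) //; apply/imsetP => -[O _ /setP /(_ j)].
rewrite inE eqxx => /esym /imsetP [x _ /eqP].
by rewrite (negPf (neq_lift j x)).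
Qed.

(* Every permutation of [N + 1] points arises once by inserting the point [0]
   in front of the point [j] in a cycle of a permutation of the other points,
   or, for [j = 0], as a new fixed point. *)
Definition insert_perm N (p : 'S_N * 'I_N.+1) : 'S_N.+1 :=
  (lift_perm ord0 ord0 p.1 * tperm ord0 p.2)%g.

Lemma insert_perm_inj N : injective (@insert_perm N).
Proof.
move=> [s j] [t k] /= eq_st.
have ins0 (u : 'S_N) l : insert_perm (u, l) ord0 = l.
  by rewrite permM lift_perm_id tpermL.
have eq_jk : j = k by rewrite -(ins0 s j) eq_st ins0.
congr (_, _) => //; move: eq_st.
rewrite /insert_perm -eq_jk => /mulIg /= eq_lift.
apply/permP => x; apply: (@lift_inj _ ord0).
by rewrite -!(lift_perm_lift ord0) eq_lift.
Qed.

Lemma insert_perm_bij N : bijective (@insert_perm N).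
Proof.
apply: inj_card_bij (@insert_perm_inj N) _.
by rewrite card_prod !card_Sn card_ord factS mulnC.
Qed.

Lemma card_porbits_insert N (s : 'S_N) j :
  #|porbits (insert_perm (s, lift ord0 j))| = #|porbits s|.
Proof.
set t := lift_perm ord0 ord0 s.
(* The transposition merges the singleton of 0 with the cycle of [j]. As [porbits_mul_tperm]
   multiplies on the left, inverses, which have the same cycles, are used. *)
have := porbits_mul_tperm t^-1 ord0 (lift ord0 j) => /=.
rewrite porbitsV -(porbitsV (_ * _)) invMg invgK tpermV card_porbits_lift.
have -> : ord0 \notin porbit t^-1 (lift ord0 j).
  rewrite porbitV; apply/porbitP => -[i].
  by move/eqP; rewrite lift_permX_lift (negPf (neq_lift _ _)).
by rewrite /insert_perm -/t addn1 addn2 => -[].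
Qed.

(** The point 0 always moves, and a fixed point of [s] stays fixed unless it is [j], which then maps
    to 0. *)
Lemma insert_perm_moves N (s : 'S_N) j :
  [forall x, insert_perm (s, lift ord0 j) x != x] =
  [forall x, (s x != x) || (x == j)].
Proof.
have insE x : insert_perm (s, lift ord0 j) (lift ord0 x) =
    if s x == j then ord0 else lift ord0 (s x).
  rewrite permM lift_perm_lift /=; case: eqP => [->|/eqP neq_sxj].
    by rewrite tpermR.
  by rewrite tpermD ?neq_lift // (inj_eq (@lift_inj _ _)) eq_sym.
apply/forallP/forallP => move_s x.
  have := move_s (lift ord0 x); rewrite insE.
  have [eq_sxj _ | neq_sxj] := eqVneq (s x) j.
    by rewrite -eq_sxj [_ == s x]eq_sym orNb.
  by rewrite (inj_eq (@lift_inj _ _)) => ->.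
case: (unliftP ord0 x) => [y|] ->; last first.
  by rewrite permM lift_perm_id tpermL eq_sym neq_lift.
rewrite insE; have [eq_syj | neq_syj] := eqVneq (s y) j.
  by rewrite neq_lift.
rewrite (inj_eq (@lift_inj _ _)); have /orP [//|/eqP eq_yj] := move_s y.
by rewrite {2}eq_yj.
Qed.

(* Taking [0] out of its cycle leaves a derangement, or a permutation whose only
   fixed point is [j] when that cycle was [(0 j)]. *)
Lemma derangementsS N k : derangements N.+1 k = 
  N * derangements N k +
  \sum_(j < N) \sum_(s : 'S_N | s j == j)
    ((#|porbits s| == k) && [forall x, (s x != x) || (x == j)]).
Proof.
rewrite derangementsE (reindex _ (onW_bij _ (@insert_perm_bij N))) /=.
transitivity (\sum_(s : 'S_N) \sum_(j < N.+1) (let t := insert_perm (s, j) in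
    (#|porbits t| == k) && [forall x, t x != x] : nat)).
  by rewrite pair_big; apply: eq_bigr => -[].
rewrite exchange_big big_ord_recl big1 ?add0n /= => [|s _]; last first.
  case: andP => // -[_ /forallP /(_ ord0)].
  by rewrite permM lift_perm_id tperm1 perm1 eqxx.
rewrite -[N in N * _]card_ord -sum_nat_const -big_split.
apply: eq_bigr => j _ /=.
(* When [s] moves [j], the exception at [j] is void and [s] is a derangement; the other [s] form the
   second sum. *)
rewrite (bigID (fun s : 'S_N => s j == j)) /= addnC; congr (_ + _).
  rewrite derangementsE [RHS](bigID (fun s : 'S_N => s j == j)) /= [RHS]addnC.
  rewrite [X in _ = _ + X]big1 ?addn0 => [|s /eqP sj]; last first.
    by case: andP => // -[_ /forallP /(_ j)]; rewrite sj eqxx.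
  apply: eq_bigr => s sj; rewrite card_porbits_insert insert_perm_moves.
  congr (nat_of_bool (_ && _)); apply: eq_forallb => x.
  by have [-> | _] := eqVneq x j; rewrite ?sj ?orbF.
by apply: eq_bigr => s _; rewrite card_porbits_insert insert_perm_moves.
Qed.

Lemma one_fixpoint N (j : 'I_N.+1) k :
  \sum_(s : 'S_N.+1 | s j == j)
    ((#|porbits s| == k.+1) && [forall x, (s x != x) || (x == j)]) =
  derangements N k.
Proof.
rewrite derangementsE (reindex (lift_perm j j)) /=; last first.
  (* The inverse of [lift_perm j j]. It must be injective for every [s], so the value [s j] is
     deleted instead of [j]; the default [x] is never reached. *)
  pose d (s : 'S_N.+1) x := odflt x (unlift (s j) (s (lift j x))).
  have dK (s : 'S_N.+1) x : lift (s j) (d s x) = s (lift j x).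
    rewrite /d; have := neq_lift j x.
    by rewrite -(inj_eq (@perm_inj _ s)) => /unlift_some [? ? ->].
  have d_inj s : injective (d s).
    move=> x y eq_d; have := congr1 (lift (s j)) eq_d.
    by rewrite !dK => /perm_inj /lift_inj.
  exists (fun s => perm (@d_inj s)) => [s _ | s /eqP sj].
    apply/permP => x; rewrite permE; apply: (@lift_inj _ j).
    by rewrite -{1}(lift_perm_id j j s) dK lift_perm_lift.
  apply/permP => x.
  case: (unliftP j x) => [y|] ->; last by rewrite lift_perm_id sj.
  by rewrite lift_perm_lift permE -dK sj.
apply: eq_big => [s | s _]; first by rewrite lift_perm_id eqxx.
rewrite card_porbits_lift eqSS; congr (nat_of_bool (_ && _)).
apply/forallP/forallP => move_s x.
  have := move_s (lift j x); rewrite lift_perm_lift (inj_eq (@lift_inj _ _)).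
  by rewrite [lift j x == j]eq_sym (negPf (neq_lift _ _)) orbF.
case: (unliftP j x) => [y|] ->; last by rewrite eqxx orbT.
by rewrite lift_perm_lift (inj_eq (@lift_inj _ _)) move_s.
Qed.

End Derangements.

(** * The recurrence in the indices of the Stirling numbers *)

Section Recurrence.

Local Open Scope nat_scope.

Lemma derangements_rec N k : derangements N.+2 k.+1 =
  N.+1 * (derangements N.+1 k.+1 + derangements N k).
Proof.
rewrite derangementsS mulnDr; congr (_ + _).
under eq_bigr => j _ do rewrite one_fixpoint.
by rewrite sum_nat_const card_ord.
Qed.

Lemma derangements0 k : derangements 0 k = (k == 0).
Proof.
rewrite derangementsE (eq_bigr (fun=> (k == 0 : nat))) => [|s _].
  by rewrite sum_nat_const card_Sn mul1n.
rewrite (_ : #|porbits s| = 0) => [|]; last first.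
  by apply: eq_card0 => O; apply/imsetP => -[[]].
by rewrite [0 == k]eq_sym (_ : [forall x, _]) ?andbT //; apply/forallP => -[].
Qed.

Lemma derangements_cycles0 N : derangements N.+1 0 = 0.
Proof.
rewrite derangementsE big1 // => s _; case: eqP => // /eqP.
by rewrite cards_eq0 => /eqP/setP/(_ (porbit s ord0)); rewrite inE imset_f.
Qed.

(** Each cycle takes at least two points; the recurrence gives this by induction. *)
Lemma derangements_eq0 N k : N < k.*2 -> derangements N k = 0.
Proof.
elim/ltn_ind: N k => -[|[|N]] IHN [|k] // lt_Nk.
- by rewrite derangements0.
- by rewrite derangementsS big_ord0.
by rewrite derangements_rec !IHN ?muln0 //; lia.
Qed.

Lemma stirling_cycle2_0 k : stirling_cycle2 0 k = (k == 0).
Proof.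
case: k => [|k]; first exact: derangements0.
by apply: derangements_eq0; lia.
Qed.

Lemma stirling_cycle2_S0 n : stirling_cycle2 n.+1 0 = n * stirling_cycle2 n 0.
Proof.
by case: n => [|n]; rewrite /stirling_cycle2 ?addn0 -!/(derangements _ 0)
  !derangements_cycles0 ?muln0.
Qed.

(** With [N = n + k], adding one point and one cycle keeps the first index [n], and adding two
    points and one cycle raises it to [n + 1]. *)
Lemma stirling_cycle2_SS n k : stirling_cycle2 n.+1 k.+1 =
  (n + k.+1) * (stirling_cycle2 n k.+1 + stirling_cycle2 n k).
Proof.
have := derangements_rec (n + k) k.
by rewrite /stirling_cycle2 -!/(derangements _ _) addSnnS !addnS.
Qed.

End Recurrence.

Lemma stirling_cycle2_polyE n N : (n.*2 < N)%N ->
  stirling_cycle2_poly n = output N (fun i j => stirling_production N j i) n 0.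
Proof.
move=> lt_nN; rewrite output_stirling_production //; last first.
  exact: leq_ltn_trans lt_nN.
rewrite (iter_stirling_op stirling_cycle2_0 stirling_cycle2_S0
  stirling_cycle2_SS).
rewrite /stirling_cycle2_poly big_mkord coef_sum; apply: eq_bigr => k _.
(* At [b = 0] every power of [ypoly] equals 1. *)
by rewrite -horner_coef0 /ypoly !hornerE ?mulr0 ?addr0 ?expr1n ?mulr1.
Qed.

Theorem theorem1p5 :
  coefficientwise_hankel_totally_positive stirling_cycle2_poly.
Proof.
exact: hankel_tp_production tp_stirling_production stirling_cycle2_polyE.
Qed.
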